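(* Let $q$ be a prime power and $k$ a positive integer, and let $m(k,q)$ denote the minimal length $n$ of a minimal $[n,k]_q$ linear code. If $q>2$, then \[ m(k,q) \leq \left\lceil \frac{2}{1+\frac{1}{(q+1)^2\ln q}}(k-1)\right\rceil(q+1). \] If $q=2$, then \[ m(k,2)\leq \frac{2k-1}{\log_2(\frac{4}{3})}. \]
   Context: $\mathbb{F}_q$ is the field with $q$ elements. An $[n,k]_q$ code is a $k$-dimensional linear subspace of $\mathbb{F}_q^n$. The support of a codeword $c$ is the set of coordinates $i$ with $c_i\neq 0$. A codeword $c$ is minimal if the only codewords whose support is contained in the support of $c$ are the scalar multiples of $c$; a code is minimal if all of its codewords are minimal.
   Formalization: For q>2 the bound is stated only for k≥2, because at k=1 the printed right-hand side is 0 while m(1,q)=1; the bound for q=2 keeps every positive k. *)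

(* Defs.v *)
From HB Require Import structures.
From mathcomp Require Import all_boot all_order all_algebra.
From mathcomp Require Import all_classical all_reals all_analysis.

Set Implicit Arguments.
Unset Strict Implicit.
Unset Printing Implicit Defensive.

Import Order.TTheory GRing.Theory Num.Theory.
Local Open Scope ring_scope.

Definition log2 (R : realType) (x : R) : R := ln x / ln 2.

Section MinimalCodes.
Variable F : finFieldType.

Definition supp (n : nat) (c : 'rV[F]_n) : {set 'I_n} := [set i | c 0 i != 0]%SET.

Definition minimal_codeword (n : nat) (C : {vspace 'rV[F]_n}) (c : 'rV[F]_n) : Prop :=
  forall c' : 'rV[F]_n, c' \in C -> supp c' \subset supp c ->
    exists a : F, c' = a *: c.

Definition minimal_code (n : nat) (C : {vspace 'rV[F]_n}) : Prop :=
  forall c : 'rV[F]_n, c \in C -> minimal_codeword C c.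

Definition has_minimal_code (k n : nat) : Prop :=
  exists C : {vspace 'rV[F]_n}, \dim C = k /\ minimal_code C.

(* The code whose generator matrix has all the vectors of F^k as columns. *)
Lemma ex_minimal_code (k : nat) : exists n, `[< has_minimal_code k n >].
Proof.
pose G := \matrix_(i < k, j < #|{: 'rV[F]_k}|) (enum_val j) 0 i.
have Gcol (x : 'rV[F]_k) (u : 'cV[F]_k) :
    (x *m G) 0 (enum_rank u^T) = (x *m u) 0 0.
  by rewrite !mxE; apply: eq_bigr => i _; rewrite !mxE enum_rankK mxE.
have suppG (x y : 'rV[F]_k) : supp (x *m G) \subset supp (y *m G) ->
    exists a, x = a *: y.
  move=> /fintype.subsetP sxy; apply/sub_rVP; rewrite submxE; apply/eqP/rowP => j.
  have yj0 : (y *m col j (cokermx y)) 0 0 = 0.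
    by rewrite colE mulmxA mulmx_coker mul0mx mxE.
  have := sxy (enum_rank (col j (cokermx y))^T).
  rewrite !inE !Gcol yj0 eqxx => /contraTN/(_ isT)/negPn/eqP xj0.
  by move: xj0; rewrite colE mulmxA -colE mxE => ->; rewrite mxE.
pose f := linfun (mulmxr G : 'rV[F]_k -> _).
have fE x : f x = x *m G by rewrite lfunE.
exists #|{: 'rV[F]_k}|; apply/asboolP; exists (limg f); split.
  rewrite limg_dim_eq ?dimvf ?/dim /= ?mul1n //; apply/eqP.
  rewrite -subv0; apply/subvP => x; rewrite memv_cap memv_ker fE memv0.
  case/andP=> _ /eqP xG0; have [|a ->] := suppG x 0; last by rewrite scaler0.
  by rewrite xG0 mul0mx.
move=> _ /memv_imgP[y _ ->] _ /memv_imgP[x _ ->]; rewrite !fE => /suppG[a ->].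
by exists a; rewrite scalemxAl.
Qed.

Definition min_minimal_length (k : nat) : nat := ex_minn (ex_minimal_code k).

End MinimalCodes.

(* Main.v *)
(* Encode the failure of minimality as a pair of independent messages, the rows y,
   x of a 2 x k matrix W, with supp (x G) contained in supp (y G).  Columns of G are
   chosen greedily: since W u is uniformly distributed when u is, some choice of u
   keeps at most the average proportion of the violating pairs.  Violating pairs
   come in classes of size q (q - 1)^2 (replace y by a y and x by b y + c x), so it
   suffices to push their number below that.

   For q > 2 the blocks u consist of the q + 1 points of a (possibly degenerate)
   line, and the proportion of surviving pairs is at most
   (q^3 - q + 1) / q^4 <= exp (- (ln q + 1 / (q + 1)^2)).

   For q = 2 single columns are added.  Since the zero column kills nothing, some
   nonzero column keeps strictly less than 3/4 of the N pairs, whence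
   4 (N' + 1) <= 3 (N + 1) by integrality.  This gain compensates for rounding the
   length down. *)
Require Import Defs.
From mathcomp Require Import all_boot all_order all_algebra.
From mathcomp Require Import all_classical all_reals all_analysis.
From mathcomp Require Import zify ring lra.
Import Order.TTheory GRing.Theory Num.Theory.
Local Open Scope ring_scope.

(** * Violating pairs of messages and the size of their classes *)

Definition supp_contained {F : finFieldType} {n : nat} (B : 'M[F]_(2, n)) : bool :=
  [forall j, (B 0 j == 0) ==> (B 1 j == 0)].

(* Row 0 of W plays the role of y and row 1 that of x. *)
Definition violations {F : finFieldType} {k n : nat} (G : 'M[F]_(k, n)) :
    {set 'M[F]_(2, k)} :=
  [set W : 'M[F]_(2, k) | row_free W && supp_contained (W *m G)]%SET.

Lemma supp_containedP {F : finFieldType} {n : nat} (B : 'M[F]_(2, n)) :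
  reflect (forall j, B 0 j = 0 -> B 1 j = 0) (supp_contained B).
Proof.
apply: (iffP forallP) => H j.
  by move=> /eqP Bj0; apply/eqP; apply: implyP (H j) Bj0.
by apply/implyP => /eqP Bj0; apply/eqP; apply: H.
Qed.

Lemma supp_contained_row_mx {F : finFieldType} {m n : nat}
    (A : 'M[F]_(2, m)) (B : 'M[F]_(2, n)) :
  supp_contained (row_mx A B) = supp_contained A && supp_contained B.
Proof.
apply/supp_containedP/andP => [H|[/supp_containedP HA /supp_containedP HB] j].
  split; apply/supp_containedP => j.
    by have := H (lshift n j); rewrite !row_mxEl.
  by have := H (rshift m j); rewrite !row_mxEr.
case: (split_ordP j) => j' ->.
  by rewrite !row_mxEl; apply: HA.
by rewrite !row_mxEr; apply: HB.
Qed.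

Lemma violations_row_mx {F : finFieldType} {k m n : nat}
    (A : 'M[F]_(k, m)) (B : 'M[F]_(k, n)) :
  violations (row_mx A B) =
  [set W in violations B | supp_contained (W *m A)]%SET.
Proof.
apply/setP => W; rewrite !inE mul_mx_row supp_contained_row_mx.
by rewrite -andbA [supp_contained (W *m A) && _]andbC.
Qed.

(** Strict because the zero matrix is not row free; this spare unit starts the induction on [N + 1]
    in the binary case. *)
Lemma card_violations_lt {F : finFieldType} {k n : nat} (G : 'M[F]_(k, n)) :
  (#|violations G| < #|F| ^ (2 * k))%N.
Proof.
rewrite -card_mx -cardsT; apply: proper_card; apply/properP.
split; first exact: finset.subsetT.
by exists 0; rewrite ?inE // negb_and /row_free mxrank0.
Qed.

Lemma ord2P (i : 'I_2) : i = 0 \/ i = 1.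
Proof. by case: i => [[|[|//]] Hi]; [left|right]; apply: val_inj. Qed.

Lemma mulmx2E {F : finFieldType} {m n : nat}
    (A : 'M[F]_(m, 2)) (B : 'M[F]_(2, n)) i j :
  (A *m B) i j = A i 0 * B 0 j + A i 1 * B 1 j.
Proof.
rewrite mxE !big_ord_recl big_ord0 addr0.
by congr (_ + A i _ * B _ j); apply: val_inj.
Qed.

(** Left multiplication by [P] rescales row 0, keeping its zeros, and turns row 1 into a combination
    of both rows, which still vanishes at those zeros. *)
Lemma mul_lower_triangular_violations {F : finFieldType} {k n : nat}
    {G : 'M[F]_(k, n)} {W : 'M[F]_(2, k)} (P : 'M[F]_2) :
  W \in violations G -> P 0 1 = 0 -> P 0 0 != 0 -> P 1 1 != 0 ->
  P *m W \in violations G.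
Proof.
rewrite !inE => /andP[Wfree /supp_containedP WG] P01 P00 P11.
have Punit : P \in unitmx.
  rewrite unitmxE det_trig; last first.
    apply/is_trig_mxP => i j.
    by case: (ord2P i) => ->; case: (ord2P j) => ->.
  rewrite unitfE; apply/prodf_neq0 => i _.
  by case: (ord2P i) => ->.
rewrite /row_free mxrankMfree // -/(row_free P) row_free_unit Punit /=.
apply/supp_containedP => j; rewrite -mulmxA !mulmx2E P01 mul0r addr0.
move=> /eqP; rewrite mulf_eq0 (negPf P00) /= => /eqP H0.
by rewrite H0 WG // !mulr0 addr0.
Qed.

(** Invertible lower triangular matrices act freely on violations, as [W] is row free, so a single
    violation brings an orbit of this size. *)
Lemma card_violations_ge {F : finFieldType} {k n : nat} (G : 'M[F]_(k, n)) :
  violations G != finset.set0 ->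
  (#|F| * #|F|.-1 ^ 2 <= #|violations G|)%N.
Proof.
case/set0Pn => W WG.
have Wfree : row_free W by move: WG; rewrite inE => /andP[].
pose P (t : F * F * F) : 'M[F]_2 :=
  \matrix_(i, j) if i == 0 then if j == 0 then t.1.1 else 0
                 else if j == 0 then t.1.2 else t.2.
pose D := finset.setX (finset.setX [set~ (0 : F)] [set: F]) [set~ (0 : F)].
have -> : (#|F| * #|F|.-1 ^ 2)%N = #|(fun t => P t *m W) @: D|.
  rewrite card_in_imset.
    by rewrite !cardsX !cardsC1 cardsT; ring.
  move=> [[a b] c] [[a' b'] c'] _ _ /(row_free_inj Wfree) /matrixP PP.
  by have := (PP 0 0, PP 1 0, PP 1 1); rewrite !mxE /= => -[[-> ->] ->].
apply: subset_leq_card; apply/fintype.subsetP => _ /imsetP[[[a b] c] + ->].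
rewrite 2!finset.in_setX !finset.in_setC1 finset.in_setT andbT => /andP[a0 c0].
by apply: (mul_lower_triangular_violations _ WG); rewrite !mxE.
Qed.

(** * From the absence of violations to a minimal code *)

Lemma min_minimal_length_le {F : finFieldType} {k n : nat} (G : 'M[F]_(k, n)) :
  (forall x y : 'rV[F]_k, supp (x *m G) \subset supp (y *m G) ->
     exists a, x = a *: y) ->
  (min_minimal_length F k <= n)%N.
Proof.
move=> suppG.
suff : has_minimal_code F k n.
  rewrite /min_minimal_length => codeF; case: ex_minnP => m _; apply.
  exact/asboolP.
pose f := linfun (mulmxr G : 'rV[F]_k -> _).
have fE x : f x = x *m G by rewrite lfunE.
exists (limg f); split.
  rewrite limg_dim_eq ?dimvf ?/dim /= ?mul1n //; apply/eqP.
  rewrite -subv0; apply/subvP => x; rewrite memv_cap memv_ker fE memv0.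
  case/andP=> _ /eqP xG0; have [|a ->] := suppG x 0; last by rewrite scaler0.
  by rewrite xG0 mul0mx.
move=> _ /memv_imgP[y _ ->] _ /memv_imgP[x _ ->]; rewrite !fE => /suppG[a ->].
by exists a; rewrite scalemxAl.
Qed.

Lemma pair_row_free {F : finFieldType} {k : nat} (x y : 'rV[F]_k) :
  y != 0 -> (forall a, x <> a *: y) ->
  row_free (\matrix_(i < 2) if i == 0 then y else x).
Proof.
move=> y0 xy; apply: inj_row_free => v.
set W := matrix_of_fun _ _; move=> /rowP vW.
have vW0 j : v 0 0 * y 0 j + v 0 1 * x 0 j = 0.
  by have := vW j; rewrite mulmx2E !mxE.
have v1 : v 0 1 = 0.
  apply/eqP/negPn/negP => v1; case: (xy (- (v 0 0 / v 0 1))).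
  apply/rowP => j; rewrite !mxE; apply: (mulfI v1).
  by move/eqP: (vW0 j); rewrite addrC addr_eq0 => /eqP ->; field.
have v0 : v 0 0 = 0.
  apply/eqP/negPn/negP => v0; case/negP: y0; apply/eqP/rowP => j.
  have /eqP := vW0 j; rewrite v1 mul0r addr0 mulf_eq0 (negPf v0) => /eqP ->.
  by rewrite mxE.
by apply/rowP => j; rewrite mxE; case: (ord2P j) => ->.
Qed.

Lemma min_minimal_length_le_no_violations {F : finFieldType} {k n : nat}
    (G : 'M[F]_(k, n)) :
  (1 < k)%N -> violations G = finset.set0 -> (min_minimal_length F k <= n)%N.
Proof.
move=> k1 G0; apply: (min_minimal_length_le G) => x y xy.
have noviol u v : v != 0 -> (forall a, u <> a *: v) ->
    supp (u *m G) \subset supp (v *m G) -> False.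
  move=> v0 uv /fintype.subsetP suv.
  suff : (\matrix_(i < 2) if i == 0 then v else u) \in violations G.
    by rewrite G0 inE.
  rewrite inE pair_row_free //=; apply/supp_containedP => j.
  have E i : ((\matrix_(i < 2) if i == 0 then v else u) *m G) i j =
      ((if i == 0 then v else u) *m G) 0 j.
    by rewrite -[in RHS](rowK (fun i : 'I_2 => if i == 0 then v else u)) -row_mul
      [RHS]mxE.
  rewrite !E /= => vj; apply/eqP/negPn/negP => uj.
  by have := suv j; rewrite !inE uj vj eqxx => /(_ isT).
apply: contrapT => nxy.
have xay a : x <> a *: y by move=> xy'; apply: nxy; exists a.
have [y0|y0] := eqVneq y 0; last exact: noviol y0 xay xy.
have x0 : x != 0 by apply/eqP => x0; apply: (xay 0); rewrite scale0r.
(* With [y = 0] the pair is dependent, so [y] is replaced by some [z] off the line of [x], available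
   because [1 < k]; the support of [x *m G] is empty, hence contained in any other. *)
have [z zx] : exists z : 'rV[F]_k, ~~ (z <= x)%MS.
  apply: contrapT => Hz; have : (1%:M <= x)%MS.
    apply/row_subP => i; apply: contrapT => /negP Hi; apply: Hz.
    by exists (row i 1%:M).
  by move=> /mxrankS; rewrite mxrank1 leqNgt (leq_ltn_trans (rank_leq_row _)).
have z0 : z != 0 by apply: contraNneq zx => ->; rewrite sub0mx.
apply: (noviol x z z0).
  move=> a xa; case/negP: zx; apply/sub_rVP; exists a^-1.
  rewrite xa scalerA mulVf ?scale1r //.
  by apply: contraNneq x0 => a0; rewrite xa a0 scale0r.
apply: fintype.subset_trans xy _; rewrite y0 mul0mx.
by apply/fintype.subsetP => j; rewrite !inE mxE eqxx.
Qed.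

(** * Averaging, and uniformity of [W *m u] *)

Lemma card_set_sum {T : finType} (A : {set T}) (p : pred T) :
  #|[set x in A | p x]%SET| = (\sum_(x in A) p x)%N.
Proof.
by rewrite -sum1dep_card big_mkcondr; apply: eq_bigr => x _; case: (p x).
Qed.

(** Double counting of the pairs [(u, i)] related by [r]: if every [u] in [D] kept more than the
    fraction [a / b] of [S], summing over [D] would contradict the bound for each [i]. *)
Lemma exists_below_average {U I : finType} (D : {set U}) (S : {set I})
    (r : U -> I -> bool) (a b : nat) :
  (0 < #|D|)%N ->
  (forall i, i \in S -> (#|[set u in D | r u i]%SET| * b <= a * #|D|)%N) ->
  exists2 u, u \in D & (#|[set i in S | r u i]%SET| * b <= a * #|S|)%N.
Proof.
move=> D0 Hr; apply: contrapT => Hno.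
have lt_card u : u \in D -> (a * #|S| < #|[set i in S | r u i]%SET| * b)%N.
  by move=> uD; rewrite ltnNge; apply/negP => le_card; apply: Hno; exists u.
have : (\sum_(u in D) (a * #|S|).+1 <=
        \sum_(u in D) #|[set i in S | r u i]%SET| * b)%N by apply: leq_sum.
rewrite sum_nat_const -big_distrl /=.
under eq_bigr do rewrite card_set_sum.
rewrite exchange_big /= big_distrl /=.
under eq_bigr do rewrite -card_set_sum.
have : (\sum_(i in S) #|[set u in D | r u i]%SET| * b <=
        \sum_(i in S) a * #|D|)%N by apply: leq_sum.
rewrite sum_nat_const; nia.
Qed.

(** A right inverse [V] of [W] makes [u] to [W *m u] onto, with fibres that are translates of the
    kernel; hence [W *m u] is uniform for uniform [u]. *)
Lemma card_mulmx_preim {F : finFieldType} {r k s : nat} (W : 'M[F]_(r, k))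
    (T : {set 'M[F]_(r, s)}) :
  row_free W ->
  (#|[set u : 'M[F]_(k, s) | W *m u \in T]%SET| * #|F| ^ (r * s) =
   #|T| * #|F| ^ (k * s))%N.
Proof.
case/row_freeP => V WV.
pose c := #|[set u : 'M[F]_(k, s) | W *m u == 0]%SET|.
have fiber B : #|[set u : 'M[F]_(k, s) | W *m u == B]%SET| = c.
  rewrite -(card_imset _ (addrI (- (V *m B)))); apply: eq_card => u.
  apply/imsetP/idP => [[v + ->]|]; rewrite !inE.
    by move=> /eqP <-; rewrite mulmxDr mulmxN !mulmxA WV mul1mx addNr.
  move=> /eqP Wu; exists (u + V *m B); last by rewrite addrC addrK.
  by rewrite inE mulmxDr Wu mulmxA WV mul1mx add0r.
have preim (T' : {set 'M[F]_(r, s)}) :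
    #|[set u : 'M[F]_(k, s) | W *m u \in T']%SET| = (#|T'| * c)%N.
  rewrite -sum1dep_card (partition_big (mulmx W) (mem T')) //=.
  rewrite -sum_nat_const; apply: eq_bigr => B BT.
  rewrite -(fiber B) -sum1dep_card; apply: eq_bigl => u.
  by case: eqP => [->|]; rewrite ?andbF // andbT.
have := preim [set: _]; rewrite cardsT card_mx.
rewrite (_ : [set _ | _]%SET = [set: 'M[F]_(k, s)]); last first.
  by apply/setP => u; rewrite !inE.
by rewrite cardsT card_mx preim => ->; ring.
Qed.

(** * Greedy columns over the binary field *)

Lemma add_column_violations {F : finFieldType} {k n : nat} (G : 'M[F]_(k, n)) :
  #|F| = 2%N -> (0 < k)%N -> violations G != finset.set0 ->
  exists u : 'cV[F]_k, (4 * #|violations (row_mx u G)| < 3 * #|violations G|)%N.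
Proof.
move=> F2 k0; rewrite -card_gt0 => G0.
pose T := [set B : 'M[F]_(2, 1) | supp_contained B]%SET.
have T3 : (#|T| <= 3)%N.
  (* The one value of [W *m u] that destroys a pair: 0 for [y] and 1 for [x]. *)
  pose B0 : 'M[F]_(2, 1) := \col_i (i == 1)%:R.
  have -> : 3%N = #|[set~ B0]%SET| by rewrite cardsC1 card_mx F2.
  apply: subset_leq_card; apply/fintype.subsetP => B; rewrite finset.in_setC1 inE.
  apply: contraL => /eqP ->; apply/supp_containedP => /(_ 0).
  by rewrite !mxE /= => /(_ erefl)/eqP; rewrite oner_eq0.
have k2 : (2 <= 2 ^ k)%N by rewrite -{1}(expn1 2) leq_exp2l.
have D0 : #|[set~ (0 : 'cV[F]_k)]%SET| = (2 ^ k).-1.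
  by rewrite cardsC1 card_mx F2 muln1.
(* At most [3 * 2^k / 4] columns keep a given pair, and dropping the zero column leaves at most
   [(3 * 2^k - 4) / 4] out of [2^k - 1], a ratio strictly below [3 / 4]. *)
have [||u _] := @exists_below_average _ _ [set~ (0 : 'cV[F]_k)]%SET
    (violations G) (fun u W => supp_contained (W *m u))
    (3 * 2 ^ k - 4) (4 * (2 ^ k).-1).
- by rewrite D0; lia.
- move=> W; rewrite inE => /andP[Wfree _]; rewrite D0.
  have := card_mulmx_preim W T Wfree; rewrite F2.
  have -> : [set u : 'cV[F]_k | W *m u \in T]%SET =
      (0 |: [set u in [set~ 0] | supp_contained (W *m u)])%SET.
    apply/setP => u; rewrite !inE; case: eqVneq => //= ->.
    by apply/supp_containedP => j _; rewrite mulmx0 mxE.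
  rewrite cardsU1 !inE eqxx /=.
  rewrite !muln1 -[(2 ^ 2)%N]/4%N; set N := #|_| => cardN.
  have {cardN} : (N * 4 <= 3 * 2 ^ k - 4)%N.
    by have := leq_mul T3 (leqnn (2 ^ k)); rewrite -cardN; lia.
  by move/(leq_mul (leqnn (2 ^ k).-1)); lia.
rewrite -violations_row_mx => Hu; exists u.
by move: Hu; set N := #|violations (row_mx _ _)|; nia.
Qed.

Lemma exists_few_violations_binary {F : finFieldType} {k : nat} (n : nat) :
  #|F| = 2%N -> (0 < k)%N ->
  exists G : 'M[F]_(k, n), violations G = finset.set0 \/
    (4 ^ n * #|violations G|.+1 <= 3 ^ n * 4 ^ k)%N.
Proof.
move=> F2 k0; elim: n => [|n [G IH]].
  exists 0; right; rewrite !mul1n -[4%N]/(2 ^ 2)%N -expnM.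
  by rewrite (leq_trans (card_violations_lt _)) // F2.
have [G0|G0] := eqVneq (violations G) finset.set0.
  exists (row_mx (0 : 'cV_k) G : 'M[F]_(k, 1 + n)); left.
  by apply/setP => W; rewrite (violations_row_mx (0 : 'cV_k) G) G0 !inE.
have [u Hu] := add_column_violations G F2 k0 G0.
exists (row_mx u G : 'M[F]_(k, 1 + n)); right.
case: IH => [G0'|IH]; first by rewrite G0' eqxx in G0.
set V := violations _.
have {}Hu : (4 * #|V|.+1 <= 3 * #|violations G|.+1)%N.
  by have := Hu : (4 * #|V| < _)%N; lia.
rewrite !expnSr -mulnA (leq_trans (leq_mul (leqnn _) Hu)) //.
by rewrite mulnCA [(3 ^ n * 3)%N]mulnC -mulnA leq_mul2l IH orbT.
Qed.

(** * Blocks of points on a line *)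

(** The columns [(1, 0)] and [(c, 1)] represent each point of the projective line over [F] once. *)
Definition projective_line (F : finFieldType) : 'M[F]_(2, 1 + #|F|) :=
  row_mx (\col_i (i == 0)%:R) (\matrix_(i, j) if i == 0 then enum_val j else 1).

(** A nonzero row 0 is a linear form vanishing at exactly one point of the line; row 1 vanishes
    there too, hence is a multiple of it. A zero row 0 forces row 1 to vanish everywhere. *)
Lemma supp_contained_projective_line {F : finFieldType} (B : 'M[F]_2) :
  supp_contained (B *m projective_line F) ->
  B = 0 \/ exists2 c, row 0 B != 0 & row 1 B = c *: row 0 B.
Proof.
rewrite mul_mx_row supp_contained_row_mx => /andP[/supp_containedP/(_ 0) H1].
move=> /supp_containedP H2.
have {}H1 : B 0 0 = 0 -> B 1 0 = 0.
  by move: H1; rewrite !mulmx2E !mxE /= !mulr1 !mulr0 !addr0.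
have {}H2 c : B 0 0 * c + B 0 1 = 0 -> B 1 0 * c + B 1 1 = 0.
  by have := H2 (enum_rank c); rewrite !mulmx2E !mxE /= enum_rankK !mulr1.
have [B00|B00] := eqVneq (B 0 0) 0; last first.
  right; exists (B 1 0 / B 0 0).
    by apply: contraNneq B00 => /rowP/(_ 0); rewrite !mxE => ->.
  apply/rowP => j; rewrite !mxE; case: (ord2P j) => ->; first by rewrite divfK.
  have /eqP := H2 (- B 0 1 / B 0 0) ltac:(by field).
  by rewrite addrC addr_eq0 => /eqP ->; field.
have B10 := H1 B00.
have [B01|B01] := eqVneq (B 0 1) 0; last first.
  right; exists (B 1 1 / B 0 1).
    by apply: contraNneq B01 => /rowP/(_ 1); rewrite !mxE => ->.
  apply/rowP => j; rewrite !mxE; case: (ord2P j) => ->; last by rewrite divfK.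
  by rewrite B00 B10 mulr0.
left; apply/matrixP => i j; rewrite mxE.
have := H2 0; rewrite B01 !mulr0 !add0r => /(_ erefl) B11.
by case: (ord2P i) => ->; case: (ord2P j) => ->.
Qed.

Lemma add_line_violations {F : finFieldType} {k n : nat} (G : 'M[F]_(k, n)) :
  exists u : 'M[F]_(k, 1 + #|F|),
    (#|violations (row_mx u G)| * #|F| ^ 4 <=
     (#|F| * (#|F| ^ 2).-1).+1 * #|violations G|)%N.
Proof.
pose T := [set B : 'M[F]_2 | supp_contained (B *m projective_line F)]%SET.
(* A surviving value is 0 or a nonzero row with one of its [q] multiples below it: at most
   [q (q^2 - 1) + 1] of the [q^4] matrices. *)
have cardT : (#|T| <= (#|F| * (#|F| ^ 2).-1).+1)%N.
  pose f (t : F * 'rV[F]_2) : 'M[F]_2 :=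
    \matrix_(i < 2) if i == 0 then t.2 else t.1 *: t.2.
  pose D := finset.setX [set: F] [set~ (0 : 'rV[F]_2)]%SET.
  have -> : (#|F| * (#|F| ^ 2).-1)%N = #|D|.
    by rewrite cardsX cardsT cardsC1 card_mx mul1n.
  have /subset_leq_card/leq_trans -> // : T \subset (0%R |: f @: D)%SET.
    apply/fintype.subsetP => B; rewrite inE.
    move=> /(supp_contained_projective_line B) [->|[c B0 B1]].
      exact: setU11.
    apply/setU1r/imsetP; exists (c, row 0 B).
      by rewrite finset.in_setX finset.in_setT finset.in_setC1.
    apply/row_matrixP => i; rewrite rowK.
    by case: (ord2P i) => ->.
  rewrite cardsU1 -[#|D|.+1]add1n leq_add ?leq_imset_card //.
  by case: (_ \notin _).
have [||u _] := @exists_below_average _ _ [set: 'M[F]_(k, 2)]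
    (violations G) (fun u W => supp_contained (W *m (u *m projective_line F)))
    (#|F| * (#|F| ^ 2).-1).+1 (#|F| ^ 4).
- by apply/card_gt0P; exists 0; rewrite inE.
- move=> W; rewrite inE => /andP[Wfree _].
  have := card_mulmx_preim W T Wfree; rewrite cardsT card_mx.
  have -> : [set u : 'M[F]_(k, 2) | W *m u \in T]%SET =
      [set u in [set: 'M[F]_(k, 2)] |
         supp_contained (W *m (u *m projective_line F))]%SET.
    by apply/setP => u; rewrite !inE mulmxA.
  by move=> ->; rewrite leq_mul2r cardT orbT.
by rewrite -violations_row_mx => Hu; exists (u *m projective_line F).
Qed.

Lemma exists_few_violations {F : finFieldType} {k : nat} (m : nat) :
  exists G : 'M[F]_(k, m * (1 + #|F|)),
    (#|violations G| * (#|F| ^ 4) ^ m <=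
     (#|F| * (#|F| ^ 2).-1).+1 ^ m * #|F| ^ (2 * k))%N.
Proof.
elim: m => [|m [G IH]].
  by exists 0; rewrite muln1 mul1n; apply/ltnW/card_violations_lt.
have [u Hu] := add_line_violations G.
exists (row_mx u G : 'M[F]_(k, (1 + #|F|) + m * (1 + #|F|))).
rewrite !(expnS _ m) mulnA.
apply: leq_trans (leq_mul Hu (leqnn _)) _.
by rewrite -!mulnA leq_mul2l IH orbT.
Qed.

(** Treated apart because the criterion through violations requires [1 < k]; the identity matrix
    serves as generator. *)
Lemma min_minimal_length1 (F : finFieldType) : (min_minimal_length F 1 <= 1)%N.
Proof.
apply: (min_minimal_length_le (1%:M : 'M[F]_1)) => x y; rewrite !mulmx1.
move=> /fintype.subsetP/(_ 0); rewrite !inE => xy.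
have [y0|y0] := eqVneq (y 0 0) 0.
  exists 0; apply/rowP => j; rewrite !ord1 scale0r mxE.
  by apply/eqP/negPn/negP => /xy; rewrite y0 eqxx.
by exists (x 0 0 / y 0 0); apply/rowP => j; rewrite !ord1 mxE divfK.
Qed.

(** * Logarithmic estimates *)

Lemma ln2_gt0 (R : realType) : 0 < ln 2 :> R.
Proof. by apply: ln_gt0; lra. Qed.

Lemma ln4V3_gt0 (R : realType) : 0 < ln (4 / 3) :> R.
Proof. by apply: ln_gt0; lra. Qed.

(** Exponentiating [(2k - 1) ln 2 < (n + 1) ln (4/3)] gives [4^k / 2 < (4/3)^(n+1)], cleared here of
    denominators. *)
Lemma binary_length_large (R : realType) (k n : nat) :
  (2 * k%:R - 1) / log2 (4 / 3) < n.+1%:R :> R ->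
  (4 ^ k * 3 ^ n.+1 < 2 * 4 ^ n.+1)%N.
Proof.
have l2 := ln2_gt0 R; have l43 := ln4V3_gt0 R.
rewrite /log2 ltr_pdivrMr ?divr_gt0 // mulrA ltr_pdivlMr // => Hn.
have : (4 ^+ k / 2 : R) < (4 / 3) ^+ n.+1.
  rewrite -ltr_ln ?posrE ?divr_gt0 ?exprn_gt0 //; try lra.
  rewrite ln_div ?posrE ?exprn_gt0 // !lnXn //; try lra.
  have -> : ln 4 = 2 * ln 2 :> R.
    by rewrite mulr_natl -lnXn //; congr ln; ring.
  by rewrite -[_ *+ k]mulr_natl -[_ *+ n.+1]mulr_natl; lra.
rewrite expr_div_n ltr_pdivlMr ?exprn_gt0 // mulrAC ltr_pdivrMr // [_ * 2]mulrC.
by rewrite -!natrX -!natrM ltr_nat.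
Qed.

(** By [1 + x <= exp x], the right side is at least [q^3 - q^3 / (q + 1)^2], and
    [q^3 <= (q - 1) (q + 1)^2] once [q >= 2]. *)
Lemma line_factor_le (R : realType) (q : R) : 2 <= q ->
  q * (q ^+ 2 - 1) + 1 <= q ^+ 4 * expR (- (ln q + 1 / (q + 1) ^+ 2)).
Proof.
move=> q2; have q0 : 0 < q by lra.
rewrite opprD expRD expRN lnK ?posrE //.
have -> : q ^+ 4 * (q^-1 * expR (- (1 / (q + 1) ^+ 2))) =
    q ^+ 3 * expR (- (1 / (q + 1) ^+ 2)) by field; lra.
have q10 : 0 < (q + 1) ^+ 2 by rewrite exprn_gt0 //; lra.
apply: le_trans (ler_wpM2l _ (expR_ge1Dx _)); last by rewrite exprn_ge0 // ltW.
have : q ^+ 3 / (q + 1) ^+ 2 <= q - 1.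
  by rewrite ler_pdivrMr //; nra.
by rewrite mulrDr mulrN mulr1 mul1r; lra.
Qed.

(** The hypothesis amounts to [2 (k - 1) L <= m (L + 1 / s)]; exponentiate it and bound each of the
    [m] line factors. The exponent is [2 (k - 1)] and not [2 k] because the class size later absorbs
    a factor [q^2]. *)
Lemma line_length_large (R : realType) (q k m : nat) : (2 < q)%N -> (0 < k)%N ->
  2 / (1 + 1 / ((q%:R + 1) ^+ 2 * ln q%:R)) * (k%:R - 1) <= m%:R :> R ->
  ((q * (q ^ 2).-1).+1 ^ m * q ^ (2 * k.-1) <= (q ^ 4) ^ m)%N.
Proof.
move=> q2 k0; set L : R := ln q%:R; set s : R := (q%:R + 1) ^+ 2 => Hm.
have q3 : 3 <= q%:R :> R by rewrite (ler_nat R 3).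
have L0 : 0 < L by apply: ln_gt0; lra.
have s0 : 0 < s by rewrite exprn_gt0 //; lra.
have {}Hm : 2 * k.-1%:R * L <= m%:R * (L + 1 / s).
  have E : 1 + 1 / (s * L) = (L + 1 / s) / L.
    by field; rewrite !gt_eqF.
  have Ls : 0 < L + 1 / s by rewrite addr_gt0 // divr_gt0.
  have kE : k%:R - 1 = k.-1%:R :> R.
    by rewrite -[k in LHS](prednK k0) -natr1 addrK.
  move: Hm; rewrite E kE invf_div mulrA.
  by rewrite mulrAC ler_pdivrMr // mulrAC.
have factor := line_factor_le R q%:R ltac:(lra).
rewrite -(ler_nat R) natrM !natrX -natr1 natrM -subn1.
rewrite natrB ?expn_gt0 ?(ltn_trans _ q2) //.
rewrite natrX -/s -/L in factor *.
have -> : q%:R ^+ (2 * k.-1) = expR (2 * k.-1%:R * L).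
  by rewrite -natrM expRM_natl lnK // posrE; lra.
apply: le_trans (ler_wpM2r (expR_ge0 _) (lerXn2r m _ _ factor)) _.
- by rewrite nnegrE; nra.
- by rewrite nnegrE mulr_ge0 ?expR_ge0 // exprn_ge0 //; lra.
rewrite exprMn -expRM_natl -(mulrA (_ ^+ m)) -expRD ler_piMr ?exprn_ge0 //; try lra.
by rewrite expR_le1; lra.
Qed.

(** * The two length bounds *)

Lemma min_minimal_length_binary (R : realType) (F : finFieldType) (k : nat) :
  #|F| = 2%N -> (0 < k)%N ->
  (min_minimal_length F k)%:R <= (2 * k%:R - 1) / log2 (4 / 3) :> R.
Proof.
move=> F2 k0; have l2 := ln2_gt0 R; have l43 := ln4V3_gt0 R.
have [->|k1] := eqVneq k 1%N.
  apply: (@le_trans _ _ 1).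
    by rewrite -[1 in leRHS]/(1%:R) ler_nat min_minimal_length1.
  rewrite /log2 ler_pdivlMr ?divr_gt0 // mul1r ler_pdivrMr //.
  have : ln (4 / 3) <= ln 2 :> R by rewrite ler_ln ?posrE //; lra.
  lra.
have {}k1 : (1 < k)%N by lia.
set t := (_ - 1) / _.
have t0 : 0 <= t.
  apply: divr_ge0; last by rewrite divr_ge0 ?ltW.
  have k1R : 1 <= k%:R :> R by rewrite ler1n.
  by rewrite /=; lra.
have /andP[tn /binary_length_large tn1] := truncn_itv t0.
apply: le_trans tn; rewrite ler_nat.
set n := Num.truncn t in tn1 *.
have [G] := exists_few_violations_binary n F2 k0.
case=> [|fewG]; first exact: min_minimal_length_le_no_violations.
have [G0|/card_violations_ge] := eqVneq (violations G) finset.set0.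
  exact: min_minimal_length_le_no_violations G0.
(* The two estimates give [3 (N + 1) < 8] for the number [N] of violations, so [N <= 1], whereas a
   nonempty set has at least [2 (2 - 1)^2 = 2]. *)
by rewrite F2 => G2; move: tn1; rewrite !expnS; nia.
Qed.

Lemma min_minimal_length_lines (R : realType) (F : finFieldType) (q k : nat) :
  #|F| = q -> (2 < q)%N -> (1 < k)%N ->
  (min_minimal_length F k)%:R <=
  (Num.ceil (2 / (1 + 1 / ((q%:R + 1) ^+ 2 * ln q%:R)) * (k%:R - 1) : R))%:~R
    * (q%:R + 1) :> R.
Proof.
move=> <- {q} q2 k1; set x := (X in Num.ceil X).
have q3 : 3 <= #|F|%:R :> R by rewrite (ler_nat R 3).
have L0 : 0 < ln #|F|%:R :> R by apply: ln_gt0; lra.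
have x0 : 0 <= x.
  apply: mulr_ge0; last by rewrite subr_ge0 ler1n ltnW.
  apply: divr_ge0 => //; apply: addr_ge0 => //; apply: divr_ge0 => //.
  by apply: mulr_ge0; [exact: sqr_ge0 | exact: ltW].
have ceil0 : 0 <= Num.ceil x by rewrite ceil_ge0 (lt_le_trans _ x0).
set m := `|Num.ceil x|%N.
have mE : (Num.ceil x)%:~R = m%:R :> R by rewrite -(gez0_abs ceil0).
have := ceil_ge x; rewrite mE => /(line_length_large R #|F| k m q2 (ltnW k1)) Hm.
rewrite natr1 -natrM ler_nat.
have [G] := exists_few_violations (F := F) (k := k) m => fewG.
have [G0|/card_violations_ge] := eqVneq (violations G) finset.set0.
  exact: min_minimal_length_le_no_violations G0.
move=> geG.
(* Since [q^(2k) = q^(2k-2) q^2], the [m] lines cancel all but the factor [q^2]. *)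
have small : (#|violations G| <= #|F| ^ 2)%N.
  rewrite -(leq_pmul2r (_ : 0 < (#|F| ^ 4) ^ m)%N) ?expn_gt0 ?(ltn_trans _ q2) //.
  apply: leq_trans fewG _.
  rewrite (_ : 2 * k = 2 * k.-1 + 2)%N; last by lia.
  rewrite expnD mulnA.
  by rewrite [leqRHS]mulnC leq_mul2r Hm orbT.
(* As [q < (q - 1)^2] from [q = 3] on, a full class of violations does not fit. *)
suff : (#|F| ^ 2 < #|F| * #|F|.-1 ^ 2)%N by rewrite ltnNge (leq_trans geG small).
by case: #|F| q2 => [|[|[|n]]] // _; rewrite /= !expnS !expn0; nia.
Qed.

Theorem theorem1p5 (R : realType) (F : finFieldType) (q k : nat)
    (hq : #|F| = q) (hk : (0 < k)%N) :
  ((2 < q)%N -> (1 < k)%N ->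
     (min_minimal_length F k)%:R <=
     (Num.ceil (2 / (1 + 1 / ((q%:R + 1) ^+ 2 * ln q%:R)) * (k%:R - 1) : R))%:~R
       * (q%:R + 1) :> R) /\
  (q = 2%N ->
     (min_minimal_length F k)%:R <= (2 * k%:R - 1) / log2 (4 / 3) :> R).
Proof.
split=> [q2 k1 | q2]; first exact: min_minimal_length_lines.
by apply: min_minimal_length_binary; rewrite ?hq.
Qed.
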